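(* Let $\mathfrak{h}(\lambda,\mu,\varphi,\operatorname{ad}_{\mathfrak{h}}^{\ast})$ be a Lie algebra on $\mathfrak{h}\oplus\mathfrak{a}\oplus\mathfrak{h}^{\ast}$ as described in the context, such that $\mu(x,y)(z)=\mu(y,z)(x)$ for all $x,y,z\in\mathfrak{h}$. Let $B_{\mathfrak{a}}$ be a symmetric and non-degenerate bilinear form on $\mathfrak{a}$ and let $\lambda_{\varphi}:\mathfrak{h}\times\mathfrak{h}\to\mathfrak{a}$ be the bilinear map determined by $\varphi(x)(u)(y)=-B_{\mathfrak{a}}(\lambda_{\varphi}(x,y),u)$ for all $x,y\in\mathfrak{h}$, $u\in\mathfrak{a}$. If there exists a linear map $L:\mathfrak{h}\to\mathfrak{a}$ such that (i) $e_{\varphi}(L)=0$, and (ii) $\lambda_{\varphi}=\lambda+\mathrm{d}_{\mathfrak{a}}(L)$, then $\mathfrak{h}(\lambda,\mu,\varphi,\operatorname{ad}_{\mathfrak{h}}^{\ast})$ admits an invariant metric.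
   Context: All algebras and vector spaces are finite dimensional over a field $\mathbb{F}$ of characteristic zero. An invariant metric on a Lie algebra $\mathfrak{g}$ is a non-degenerate symmetric bilinear form $B$ with $B([x,y],z)=-B(y,[x,z])$ for all $x,y,z\in\mathfrak{g}$. The Lie algebra $\mathfrak{h}(\lambda,\mu,\varphi,\operatorname{ad}_{\mathfrak{h}}^{\ast})$: the data are a Lie algebra $(\mathfrak{h},[\cdot,\cdot]_{\mathfrak{h}})$ with coadjoint representation $\operatorname{ad}_{\mathfrak{h}}^{\ast}(x)(\alpha)=-\alpha\circ\operatorname{ad}_{\mathfrak{h}}(x)$ on $\mathfrak{h}^{\ast}$; a vector space $\mathfrak{a}$ (trivial $\mathfrak{h}$-module); a linear map $\varphi:\mathfrak{h}\to\operatorname{Hom}(\mathfrak{a},\mathfrak{h}^{\ast})$ with $\varphi([x,y]_{\mathfrak{h}})=\operatorname{ad}_{\mathfrak{h}}^{\ast}(x)\circ\varphi(y)-\operatorname{ad}_{\mathfrak{h}}^{\ast}(y)\circ\varphi(x)$; and skew-symmetric bilinear maps $\lambda:\mathfrak{h}\times\mathfrak{h}\to\mathfrak{a}$, $\mu:\mathfrak{h}\times\mathfrak{h}\to\mathfrak{h}^{\ast}$ satisfying $\mathrm{d}_{\mathfrak{a}}(\lambda)=0$ and $e_\varphi(\lambda)+\mathrm{d}_{\operatorname{ad}_{\mathfrak{h}}^{\ast}}(\mu)=0$. Here $\mathrm{d}_{\mathfrak{a}}$, $\mathrm{d}_{\operatorname{ad}_{\mathfrak{h}}^{\ast}}$ are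 the Chevalley–Eilenberg differentials of $\mathfrak{h}$ with values in the trivial module $\mathfrak{a}$ and in the coadjoint module $\mathfrak{h}^{\ast}$; $e_\varphi(\lambda)(x,y,z)=\varphi(x)(\lambda(y,z))+\varphi(y)(\lambda(z,x))+\varphi(z)(\lambda(x,y))$. The Lie bracket on $\mathfrak{h}\oplus\mathfrak{a}\oplus\mathfrak{h}^{\ast}$ is the skew-symmetric bilinear map with $[x,y]=[x,y]_{\mathfrak{h}}+\lambda(x,y)+\mu(x,y)$, $[x,u+\alpha]=\varphi(x)(u)+\operatorname{ad}_{\mathfrak{h}}^{\ast}(x)(\alpha)$, $[u+\alpha,v+\beta]=0$. For a linear map $L:\mathfrak{h}\to\mathfrak{a}$: $e_{\varphi}(L)(x,y)=\varphi(x)(L(y))-\varphi(y)(L(x))$ and $\mathrm{d}_{\mathfrak{a}}(L)(x,y)=-L([x,y]_{\mathfrak{h}})$. *)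

(* Defs.v *)
From HB Require Import structures.
From mathcomp Require Import all_boot all_order all_algebra.
From mathcomp Require Import ring.

Set Implicit Arguments.
Unset Strict Implicit.
Unset Printing Implicit Defensive.

Import GRing.Theory.
Local Open Scope ring_scope.

(* Away from characteristic 2, lie_skew is equivalent to [x, x] = 0. *)
Record lieAlgebra (F : fieldType) := LieAlgebra {
  lie_space :> vectType F;
  lie_bracket : {bilinear lie_space -> lie_space -> lie_space};
  lie_skew : forall x y, lie_bracket x y = - lie_bracket y x;
  lie_jacobi : forall x y z,
    lie_bracket x (lie_bracket y z) + lie_bracket y (lie_bracket z x)
    + lie_bracket z (lie_bracket x y) = 0
}.

Notation "''[' x , y ]" := (lie_bracket _ x y) : ring_scope.

Record is_invariant_metric (F : fieldType) (g : lieAlgebra F)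
    (B : {symmetric g}) : Prop := InvariantMetric {
  metric_nondegenerate : nondegenerate B;
  metric_invariant : forall x y z : g, B '[x, y] z = - B y '[x, z]
}.

Definition dual (F : fieldType) (V : vectType F) : vectType F := 'Hom(V, F^o).

Section Cochains.
Variables (F : fieldType) (h : lieAlgebra F).

Definition ad (x : h) : 'End(h) := linfun (lie_bracket h x).

Definition coad (x : h) (alpha : dual h) : dual h := (- (alpha \o ad x))%VF.

Definition trivial_action (V : vectType F) (x : h) (v : V) : V := 0.

(* Chevalley-Eilenberg differentials of 1- and 2-cochains of h with values in
   the h-module V, where h acts on V through rho. *)
Definition ce_diff1 (V : vectType F) (rho : h -> V -> V) (f : h -> V)
    (x y : h) : V :=
  rho x (f y) - rho y (f x) - f '[x, y].

Definition ce_diff2 (V : vectType F) (rho : h -> V -> V) (f : h -> h -> V)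
    (x y z : h) : V :=
  rho x (f y z) - rho y (f x z) + rho z (f x y)
  - f '[x, y] z + f '[x, z] y - f '[y, z] x.

Variables (a : vectType F) (phi : 'Hom(h, 'Hom(a, dual h))).

Definition e_phi1 (f : h -> a) (x y : h) : dual h := phi x (f y) - phi y (f x).

Definition e_phi2 (f : h -> h -> a) (x y z : h) : dual h :=
  phi x (f y z) + phi y (f z x) + phi z (f x y).

End Cochains.

(* The data (lambda, mu, phi) defining h(lambda, mu, phi, ad^* ). *)
Record ext_datum (F : fieldType) (h : lieAlgebra F) (a : vectType F) :=
    ExtDatum {
  ext_lambda : {bilinear h -> h -> a};
  ext_mu : {bilinear h -> h -> dual h};
  ext_phi : 'Hom(h, 'Hom(a, dual h));
  ext_lambda_skew : forall x y, ext_lambda x y = - ext_lambda y x;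
  ext_mu_skew : forall x y, ext_mu x y = - ext_mu y x;
  ext_phi_bracket : forall (x y : h) (u : a),
    ext_phi '[x, y] u = coad x (ext_phi y u) - coad y (ext_phi x u);
  ext_lambda_closed : forall x y z,
    ce_diff2 (@trivial_action F h a) ext_lambda x y z = 0;
  ext_mu_closed : forall x y z,
    e_phi2 ext_phi ext_lambda x y z + ce_diff2 (@coad F h) ext_mu x y z = 0
}.

Section Extension.
Variables (F : fieldType) (h : lieAlgebra F) (a : vectType F).
Variable D : ext_datum h a.

Local Notation lambda := (ext_lambda D).
Local Notation mu := (ext_mu D).
Local Notation phi := (ext_phi D).

Definition ext_space : vectType F := (h * a * dual h)%type.

(* [x + u + alpha, y + v + beta] obtained by bilinearity and skew-symmetry from
   the values of the bracket on the three summands. *)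
Definition ext_bracket (p q : ext_space) : ext_space :=
  let: (x, u, alpha) := p in
  let: (y, v, beta) := q in
  ('[x, y], lambda x y,
   mu x y + (phi x v + coad x beta) - (phi y u + coad y alpha)).

Lemma coadE x (alpha : dual h) z : coad x alpha z = - alpha '[x, z].
Proof. by rewrite /coad !lfunE /= lfunE /= lfunE. Qed.

Lemma dualD (f g : dual h) z : (f + g) z = f z + g z.
Proof. by rewrite lfunE. Qed.

Lemma dualN (f : dual h) z : (- f) z = - f z.
Proof. by rewrite lfunE. Qed.

Lemma dualZ c (f : dual h) z : (c *: f) z = c * f z.
Proof. by rewrite lfunE. Qed.

Lemma dualP c (f : dual h) z z' : f (c *: z + z') = c * f z + f z'.
Proof. by rewrite linearP. Qed.

Lemma phiPr c y (u u' : a) z :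
  phi y (c *: u + u') z = c * phi y u z + phi y u' z.
Proof. by rewrite linearP !lfunE /= !lfunE. Qed.

Let dualE := (dualD, dualN, dualZ, coadE).

Lemma ext_bracketE (p q : ext_space) z :
  (ext_bracket p q).2 z =
    mu p.1.1 q.1.1 z + phi p.1.1 q.1.2 z - q.2 '[p.1.1, z]
    - phi q.1.1 p.1.2 z + p.2 '[q.1.1, z].
Proof.
case: p q => [[x u] al] [[y v] be].
rewrite [LHS]/= !dualE /=; ring.
Qed.

Lemma phiP c x x' (v : a) z :
  phi (c *: x + x') v z = c * phi x v z + phi x' v z.
Proof. by rewrite linearP !lfunE /= !lfunE. Qed.

Lemma ext_spaceP (p q : ext_space) :
  p.1.1 = q.1.1 -> p.1.2 = q.1.2 -> (forall z, p.2 z = q.2 z) -> p = q.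
Proof. by case: p q => [[? ?] ?] [[? ?] ?] /= -> -> /lfunP ->. Qed.

Lemma ext_bracket_bilinear :
  bilinear_for (GRing.Scale.Law.clone _ _ *:%R _)
    (GRing.Scale.Law.clone _ _ *:%R _) ext_bracket.
Proof.
split=> [q|q] c p p'; apply: ext_spaceP => [||z].
- by case: q p p' => [[y v] be] [[x u] al] [[x' u'] al']; exact: linearPl.
- by case: q p p' => [[y v] be] [[x u] al] [[x' u'] al']; exact: linearPl.
- have E : (c *: ext_bracket p q + ext_bracket p' q).2 z
      = c * (ext_bracket p q).2 z + (ext_bracket p' q).2 z by rewrite !dualE.
  rewrite [RHS]E !ext_bracketE.
  case: q p p' {E} => [[y v] be] [[x u] al] [[x' u'] al'] /=.
  rewrite !linearPl phiP phiPr !(dualE, dualP).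
  ring.
- by case: q p p' => [[y v] be] [[x u] al] [[x' u'] al']; exact: linearPr.
- by case: q p p' => [[y v] be] [[x u] al] [[x' u'] al']; exact: linearPr.
- have E : (c *: ext_bracket q p + ext_bracket q p').2 z
      = c * (ext_bracket q p).2 z + (ext_bracket q p').2 z by rewrite !dualE.
  rewrite [RHS]E !ext_bracketE.
  case: q p p' {E} => [[y v] be] [[x u] al] [[x' u'] al'] /=.
  rewrite linearPr linearPl phiP phiPr !(dualE, dualP).
  ring.
Qed.

HB.instance Definition _ :=
  bilinear_isBilinear.Build F ext_space ext_space ext_space _ _ ext_bracket
    ext_bracket_bilinear.

Lemma ext_bracket_skew p q : ext_bracket p q = - ext_bracket q p.
Proof.
apply: ext_spaceP => [||z].
- by case: p q => [[x u] al] [[y v] be]; exact: lie_skew.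
- by case: p q => [[x u] al] [[y v] be]; exact: ext_lambda_skew.
- have E : (- ext_bracket q p).2 z = - (ext_bracket q p).2 z by rewrite dualN.
  by rewrite [RHS]E !ext_bracketE ext_mu_skew dualN; ring.
Qed.

Lemma ext_bracket_jacobi p q r :
  ext_bracket p (ext_bracket q r) + ext_bracket q (ext_bracket r p)
  + ext_bracket r (ext_bracket p q) = 0.
Proof.
apply: ext_spaceP => [||t].
- case: p q r => [[x u] al] [[y v] be] [[z w] ga]; exact: lie_jacobi.
- case: p q r => [[x u] al] [[y v] be] [[z w] ga].
  have := ext_lambda_closed D x y z.
  rewrite /ce_diff2 /trivial_action subrr !add0r => lambda0.
  rewrite [LHS]/= (ext_lambda_skew D x) (ext_lambda_skew D y).
  rewrite (ext_lambda_skew D z) (lie_skew z x) linearNl opprK addrC.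
  by rewrite -[RHS]lambda0 addrA [X in _ = X]addrAC.
- have sumE (A B C : ext_space) :
      (A + B + C).2 t = A.2 t + B.2 t + C.2 t by rewrite !dualD.
  rewrite [LHS]sumE !ext_bracketE [RHS]lfunE.
  case: p q r => [[x u] al] [[y v] be] [[z w] ga] /=.
  have := congr1 (fun f : dual h => f t) (ext_mu_closed D x y z).
  rewrite /ce_diff2 /e_phi2 !dualE [in RHS]lfunE /= => mu0.
  have adM (f : dual h) x1 x2 :
      f '['[x1, x2], t] = f '[x1, '[x2, t]] - f '[x2, '[x1, t]].
    have := congr1 f (lie_jacobi x1 x2 t).
    rewrite (lie_skew t '[x1, x2]) (lie_skew t x1) linearNr !raddfD !raddfN /=.
    by rewrite raddf0 => /eqP; rewrite subr_eq0 => /eqP->.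
  rewrite !ext_phi_bracket !dualE !adM -[RHS]mu0.
  rewrite (ext_mu_skew D '[x, y]) (ext_mu_skew D '[x, z]) (ext_mu_skew D '[y, z]).
  rewrite (lie_skew z x) (ext_mu_skew D z x) linearNr !dualN.
  ring.
Qed.

Definition ext_lie : lieAlgebra F :=
  LieAlgebra ext_bracket_skew ext_bracket_jacobi.

End Extension.

(* Main.v *)
Require Import Defs.
From HB Require Import structures.
From mathcomp Require Import all_boot all_order all_algebra.
From mathcomp Require Import ring.

Set Implicit Arguments.
Unset Strict Implicit.
Unset Printing Implicit Defensive.

Import GRing.Theory.
Local Open Scope ring_scope.

(** The graph of [L] is a better complement to [a + h^*] than [h] itself. Put
    [x' = x + L x] for [x] in [h]. Since [e_phi L = 0], the brackets become
    [[x', y'] = [x, y]' + (lambda x y - L [x, y]) + mu x y], and the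
    [a]-component is [lambda_phi x y] since [lambda_phi = lambda + d L]; the
    brackets with [a + h^*] do not change. So the extension is isomorphic to the
    one with [L = 0] and [lambda = lambda_phi], where the form
    [(x' + u + al, y' + v + be) |-> al y + be x + B_a u v] is invariant: the
    cyclicity of [mu] settles triples in [h], the definition of [lambda_phi],
    which is now skew-symmetric,
    settles those with one entry in [a], and the coadjoint action those with one
    entry in [h^*]. In the original coordinates, that form is

      [(x + u + al, y + v + be) |-> al y + be x + B_a (u - L x) (v - L y)].

    It is the hyperbolic form of [h + h^*] plus [B_a], up to the linear
    automorphism [x + u + al |-> x + (u - L x) + al], hence nondegenerate.
    [ext_form_nondegenerate] and [ext_form_invariant] carry these two facts. *)

Lemma symmetric_formC (F : fieldType) (V : vectType F) (B : {symmetric V}) u v :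
  B u v = B v u.
Proof. by rewrite hermC expr0 mul1r. Qed.

Lemma nondegenerateP (F : fieldType) (V : vectType F) (B : {symmetric V}) :
  reflect (forall u, (forall v, B u v = 0) -> u = 0) (nondegenerate B).
Proof.
apply: (iffP eqP) => [rad0 u Bu0 | inj].
  apply/eqP; rewrite -memv0 -rad0; apply/mem_orthovP => v _; exact: Bu0.
apply/eqP; rewrite -subv0; apply/subvP => u /mem_orthovP Bu0.
by rewrite memv0; apply/eqP/inj => v; apply/Bu0/memvf.
Qed.

(** Linear functionals separate the points of a finite-dimensional space. *)
Lemma dual_separates (F : fieldType) (V : vectType F) (x : V) :
  (forall f : dual V, f x = 0) -> x = 0.
Proof.
move=> x0; rewrite (coord_vbasis (memvf x)) big1 // => i _.
have := x0 (linfun (coord (vbasis fullv) i : V -> F^o)).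
by rewrite lfunE /= => ->; rewrite scale0r.
Qed.

Section ExtensionForm.
Variables (F : fieldType) (h : lieAlgebra F) (a : vectType F).
Variables (D : ext_datum h a) (B_a : {symmetric a}) (L : 'Hom(h, a)).

(** The pairing of [h] with [h^*] plus [B_a], transported along
    [x + u + al |-> x + (u - L x) + al]. *)
Definition ext_form (p q : ext_lie D) : F :=
  p.2 q.1.1 + q.2 p.1.1 + B_a (p.1.2 - L p.1.1) (q.1.2 - L q.1.1).

Lemma ext_formC p q : ext_form p q = ext_form q p.
Proof. by rewrite /ext_form symmetric_formC [p.2 _ + _]addrC. Qed.

Lemma ext_form_linearl q c p p' :
  ext_form (c *: p + p') q = c * ext_form p q + ext_form p' q.
Proof.
case: p p' q => [[x u] al] [[x' u'] al'] [[y v] be].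
rewrite /ext_form /= dualP dualD dualZ linearP.
have -> : c *: u + u' - (c *: L x + L x') = c *: (u - L x) + (u' - L x').
  by rewrite scalerBr opprD addrACA.
by rewrite linearPl /=; ring.
Qed.

Lemma ext_form_bilinear :
  bilinear_for (GRing.Scale.Law.clone _ _ *%R _)
    (GRing.Scale.Law.clone _ _ *%R _) ext_form.
Proof.
split=> [q|p] c r s /=; first exact: ext_form_linearl.
by rewrite !(ext_formC p) ext_form_linearl.
Qed.

HB.instance Definition _ :=
  bilinear_isBilinear.Build F (ext_lie D) (ext_lie D) F _ _ ext_form
    ext_form_bilinear.

Lemma ext_form_hermitian p q :
  ext_form p q = (-1) ^+ false * idfun (ext_form q p).
Proof. by rewrite expr0 mul1r ext_formC. Qed.

HB.instance Definition _ :=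
  isHermitianSesquilinear.Build F (ext_lie D) false idfun ext_form
    ext_form_hermitian.

Definition ext_metric : {symmetric (ext_lie D)} := ext_form.

Lemma ext_form_nondegenerate : nondegenerate B_a -> nondegenerate ext_metric.
Proof.
move=> /nondegenerateP B_a_inj; apply/nondegenerateP => -[[x u] al] B0.
have {}B0 y v (be : dual h) : al y + be x + B_a (u - L x) (v - L y) = 0.
  exact: (B0 (y, v, be)).
have x0 : x = 0.
  apply: dual_separates => be; have := B0 0 0 be.
  by rewrite !linear0 addr0 linear0r addr0 add0r.
have u0 : u = 0.
  apply: B_a_inj => v; have := B0 0 v 0.
  by rewrite x0 !linear0 !addr0 !add0r.
apply: (@ext_spaceP F h a (x, u, al) 0) => //= y; have := B0 y 0 0.
by rewrite x0 u0 !linear0 !addr0 linear0l addr0 lfunE.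
Qed.

Hypothesis mu_cyclic : forall x y z, ext_mu D x y z = ext_mu D y z x.
Hypothesis e_phi_L : forall x y, e_phi1 (ext_phi D) L x y = 0.
(* The relation defining lambda_phi, with lambda + d L in its place. *)
Hypothesis phiE : forall x y u,
  ext_phi D x u y = - B_a (ext_lambda D x y - L '[x, y]) u.

Let phi_skew x y u : ext_phi D x u y = - ext_phi D y u x.
Proof.
rewrite !phiE ext_lambda_skew (lie_skew x y) linearN /= -opprD.
by rewrite linearNl.
Qed.

(* phi x (L z) y is symmetric in x and z, skew in x and y: so skew in y and z. *)
Let phi_L_skew x y z : ext_phi D x (L z) y = - ext_phi D x (L y) z.
Proof.
have phi_LC t s : ext_phi D t (L s) = ext_phi D s (L t).
  by apply/eqP; rewrite -subr_eq0; apply/eqP/e_phi_L.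
by rewrite phi_LC phi_skew phi_LC.
Qed.

Lemma ext_form_invariant p q r :
  ext_metric '[p, q] r = - ext_metric q '[p, r].
Proof.
rewrite /ext_metric /= /ext_form !ext_bracketE.
case: p q r => [[x u] al] [[y v] be] [[z w] ga] /=.
(* The B_a terms are exactly those that phiE turns into values of phi. *)
have -> : B_a (ext_lambda D x y - L '[x, y]) (w - L z)
    = ext_phi D x (L z) y - ext_phi D x w y.
  by rewrite linearBr !phiE /=; ring.
have -> : B_a (v - L y) (ext_lambda D x z - L '[x, z])
    = ext_phi D x (L y) z - ext_phi D x v z.
  by rewrite symmetric_formC linearBr !phiE /=; ring.
have -> : ext_mu D x y z = - ext_mu D x z y.
  by rewrite mu_cyclic mu_cyclic ext_mu_skew dualN.
rewrite (phi_skew y z u) (phi_L_skew x y z) (lie_skew z y) (linearN al) /=.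
ring.
Qed.

End ExtensionForm.

Theorem proposition2p3 (F : fieldType) (charF0 : [pchar F] =i pred0)
    (h : lieAlgebra F) (a : vectType F) (D : ext_datum h a)
    (mu_cyclic : forall x y z : h, ext_mu D x y z = ext_mu D y z x)
    (B_a : {symmetric a}) (B_a_nondegenerate : nondegenerate B_a)
    (lambda_phi : {bilinear h -> h -> a})
    (lambda_phiE : forall (x y : h) (u : a),
       ext_phi D x u y = - B_a (lambda_phi x y) u) :
  (exists L : 'Hom(h, a),
     (forall x y : h, e_phi1 (ext_phi D) L x y = 0) /\
     (forall x y : h,
        lambda_phi x y
        = ext_lambda D x y + ce_diff1 (@trivial_action F h a) L x y)) ->
  exists B : {symmetric (ext_lie D)}, is_invariant_metric B.
Proof.
case=> L [e_phi_L lambda_phi_L]; exists (ext_metric D B_a L).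
split; first exact: ext_form_nondegenerate.
apply: ext_form_invariant => // x y u.
by rewrite lambda_phiE lambda_phi_L /ce_diff1 /trivial_action subrr add0r.
Qed.
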